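(* Let $a$ be a real number with $0\le a<1$ and let $p$ be a prime number. Then the set of real numbers $\alpha$ such that $$\liminf_{q\to+\infty}\, q\,(\log q)^{2-a}\,\|q\alpha\|\,|q|_p\,\bigl(\log(2/|q|_p)\bigr)^a>0$$ (where $q$ runs over positive integers) has Hausdorff dimension $1$.
   Context: For a real number $x$, $\|x\|$ denotes the distance from $x$ to the nearest integer. For a prime $p$, $|\cdot|_p$ is the $p$-adic absolute value normalized so that $|p|_p=p^{-1}$. *)

(* Defs.v *)
From Stdlib Require Import Reals Lra Lia ZArith Znumtheory.
Open Scope R_scope.

Definition dist_nint (x : R) : R :=
  Rmin (x - IZR (Int_part x)) (IZR (Int_part x) + 1 - x).

(* p-adic valuation of a natural number q (meaningful for p >= 2, q >= 1);
   the fuel q suffices since p^k | q, q >= 1 forces k <= q. *)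
Fixpoint vp_aux (fuel p q : nat) : nat :=
  match fuel with
  | O => O
  | S f => if (q =? 0)%nat then O
           else if (q mod p =? 0)%nat then S (vp_aux f p (q / p))
           else O
  end.
Definition vp (p q : nat) : nat := vp_aux q p q.

Definition padic_abs (p q : nat) : R := / (INR p ^ vp p q).

(* liminf_{q -> +oo} f q > 0  (liminf in [-oo,+oo]), written out:
   sup_N inf_{q >= N} f q > 0. *)
Definition liminf_pos (f : nat -> R) : Prop :=
  exists c : R, 0 < c /\ exists N : nat, forall q : nat, (N <= q)%nat -> c <= f q.

(* d^s with the convention 0^s = 0 (Stdlib's Rpower 0 s would be 1). *)
Definition hpow (d s : R) : R := if Rle_dec d 0 then 0 else Rpower d s.

(* A countable delta-cover (U n)_n of E, with d n an upper bound of diam (U n),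
   d n <= delta, and Sum_n (d n)^s <= M. Taking d n = diam (U n) is optimal since
   hpow is nondecreasing in d for s >= 0, so the infimum over such covers is
   the usual H^s_delta. *)
Definition delta_cover_sum_le (s delta : R) (E : R -> Prop) (M : R) : Prop :=
  exists (U : nat -> R -> Prop) (d : nat -> R),
    (forall n, 0 <= d n <= delta) /\
    (forall n x y, U n x -> U n y -> Rabs (x - y) <= d n) /\
    (forall x, E x -> exists n, U n x) /\
    (forall N, sum_f_R0 (fun n => hpow (d n) s) N <= M).

Definition Hdelta_le (s delta : R) (E : R -> Prop) (M : R) : Prop :=
  forall eps, 0 < eps -> delta_cover_sum_le s delta E (M + eps).

Definition Hausdorff_le (s : R) (E : R -> Prop) (M : R) : Prop :=
  forall delta, 0 < delta -> Hdelta_le s delta E M.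

Definition Hausdorff_null (s : R) (E : R -> Prop) : Prop := Hausdorff_le s E 0.

Definition is_glb (A : R -> Prop) (m : R) : Prop :=
  (forall x, A x -> m <= x) /\ (forall b, (forall x, A x -> b <= x) -> b <= m).

Definition is_hausdorff_dim (E : R -> Prop) (dim : R) : Prop :=
  is_glb (fun s => 0 <= s /\ Hausdorff_null s E) dim.

Definition good_set (a : R) (p : nat) : R -> Prop :=
  fun alpha => liminf_pos (fun q =>
    INR q * Rpower (ln (INR q)) (2 - a) * dist_nint (INR q * alpha)
      * padic_abs p q * Rpower (ln (2 / padic_abs p q)) a).

(* Main.v *)
(** Write [q = p^k m] with [m] prime to [p]: up to constants the condition says that [alpha]
    avoids the intervals of length [c / (p^k m^2 (log q)^(2-a) (k+1)^a)] around the
    fractions [r / q]. The Peres-Schlag scheme removes these intervals in stages, [alpha] in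
    [0, 1] being localised in dyadic atoms of level [L_j = 5^j N0]: those with
    [2^(L_j) <= q < 2^(L_(j+1))] are removed at level [L_(j+2)]. Inside any surviving atom of
    level [L_j] the fractions of denominator [q] are evenly spread, so the stage removes a
    proportion [O(sum_q c / (m (log q)^(2-a) (k+1)^a)) = O(c)] of the set that survived
    stage [j]: since [q] determines and is determined by [(k, m)], the sum is at most the
    product of the sum over [m], of order [L_j], and of the sum over [k], of order
    [L_j^(1-a)], while [log q] is of order [L_j]. Hence the surviving density decays at most
    like [2^-j].

    For the lower bound on the dimension, let [s < 1] and take a cover with
    [sum d_n^s <= 1]. Its members of diameter between [2^-(L_(j+2))] and [2^-(L_(j+1))] have
    total length at most [2^(-(1-s) L_(j+1))], negligible against [2^-j], so they can be
    removed along with the intervals above. The remaining point belongs to the set but not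
    to the cover. *)
Require Import Defs.
From Stdlib Require Import Reals ZArith Znumtheory Lra Lia List FinFun ClassicalEpsilon.
From Coquelicot Require Import Coquelicot.
Open Scope R_scope.

(** * Finite sums and counting *)

Definition Rsum {A : Type} (f : A -> R) (l : list A) : R := fold_right Rplus 0 (map f l).

Lemma Rsum_cons {A} (f : A -> R) x l : Rsum f (x :: l) = f x + Rsum f l.
Proof. reflexivity. Qed.

Lemma Rsum_app {A} (f : A -> R) l1 l2 : Rsum f (l1 ++ l2) = Rsum f l1 + Rsum f l2.
Proof.
  induction l1 as [|x l1 IH]; simpl; rewrite ?Rsum_cons, ?IH; [unfold Rsum; simpl|]; ring.
Qed.

Lemma Rsum_map {A B} (f : B -> R) (g : A -> B) l :
  Rsum f (map g l) = Rsum (fun x => f (g x)) l.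
Proof. unfold Rsum. now rewrite map_map. Qed.

Lemma Rsum_flat_map {A B} (f : B -> R) (g : A -> list B) l :
  Rsum f (flat_map g l) = Rsum (fun x => Rsum f (g x)) l.
Proof.
  induction l as [|x l IH]; [reflexivity|].
  simpl. now rewrite Rsum_app, IH.
Qed.

Lemma Rsum_le {A} (f g : A -> R) l :
  (forall x, In x l -> f x <= g x) -> Rsum f l <= Rsum g l.
Proof.
  induction l as [|x l IH]; intros H; [apply Rle_refl|].
  rewrite !Rsum_cons. apply Rplus_le_compat; [apply H; now left|].
  apply IH. intros y Hy. apply H. now right.
Qed.

Lemma Rsum_ext {A} (f g : A -> R) l :
  (forall x, In x l -> f x = g x) -> Rsum f l = Rsum g l.
Proof.
  intros H. apply Rle_antisym; apply Rsum_le; intros x Hx; rewrite (H x Hx); apply Rle_refl.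
Qed.

Lemma Rsum_const {A} c (l : list A) : Rsum (fun _ => c) l = INR (length l) * c.
Proof.
  induction l as [|x l IH]; [unfold Rsum; simpl; ring|].
  rewrite Rsum_cons, IH. simpl length. rewrite S_INR. ring.
Qed.

Lemma Rsum_nonneg {A} (f : A -> R) l : (forall x, In x l -> 0 <= f x) -> 0 <= Rsum f l.
Proof. intros H. rewrite <- (Rmult_0_r (INR (length l))), <- Rsum_const. now apply Rsum_le. Qed.

Lemma Rsum_plus {A} (f g : A -> R) l : Rsum (fun x => f x + g x) l = Rsum f l + Rsum g l.
Proof.
  induction l as [|x l IH]; [unfold Rsum; simpl; ring|].
  rewrite !Rsum_cons, IH. ring.
Qed.

Lemma Rsum_scal_l {A} c (f : A -> R) l : Rsum (fun x => c * f x) l = c * Rsum f l.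
Proof.
  induction l as [|x l IH]; [unfold Rsum; simpl; ring|].
  rewrite !Rsum_cons, IH. ring.
Qed.

Lemma Rsum_incl {A} (f : A -> R) l1 l2 :
  NoDup l1 -> incl l1 l2 -> (forall x, 0 <= f x) -> Rsum f l1 <= Rsum f l2.
Proof.
  intros Hnd. revert l2. induction Hnd as [|x l1 Hx _ IH]; intros l2 Hincl Hf.
  - now apply Rsum_nonneg.
  - apply incl_cons_inv in Hincl as [Hx2 Hincl].
    apply in_split in Hx2 as (u & v & ->).
    rewrite Rsum_app, !Rsum_cons.
    assert (Rsum f l1 <= Rsum f (u ++ v)).
    { apply IH; [|assumption]. intros y Hy.
      specialize (Hincl y Hy). rewrite in_app_iff in *. simpl in Hincl.
      destruct Hincl as [|[->|]]; tauto. }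
    rewrite Rsum_app in *. lra.
Qed.

Lemma Rsum_list_prod {A B} (f : A -> R) (g : B -> R) l1 l2 :
  Rsum (fun ab => f (fst ab) * g (snd ab)) (list_prod l1 l2) = Rsum f l1 * Rsum g l2.
Proof.
  induction l1 as [|a l1 IH]; [unfold Rsum; simpl; ring|].
  simpl. rewrite Rsum_app, Rsum_map, IH, Rsum_cons. simpl.
  rewrite Rsum_scal_l. ring.
Qed.

Lemma sum_f_R0_Rsum (f : nat -> R) n : sum_f_R0 f n = Rsum f (seq 0 (S n)).
Proof.
  induction n as [|n IH]; [unfold Rsum; simpl; ring|].
  rewrite seq_S, Rsum_app, <- IH. unfold Rsum. simpl. ring.
Qed.

Lemma seq_mult_flat_map K D :
  seq 0 (K * D) = flat_map (fun J => seq (J * D) D) (seq 0 K).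
Proof.
  induction K as [|K IH]; [reflexivity|].
  rewrite seq_S, flat_map_app, <- IH. simpl. rewrite app_nil_r, <- seq_app.
  f_equal. lia.
Qed.

Lemma div_in_block J D i : In i (seq (J * D) D) -> (i / D = J)%nat.
Proof.
  rewrite in_seq. intros H. symmetry. apply Nat.div_unique with (i - J * D)%nat; lia.
Qed.

Definition indicator {A : Type} (P : A -> Prop) (x : A) : R :=
  if excluded_middle_informative (P x) then 1 else 0.

Definition count {A : Type} (P : A -> Prop) (l : list A) : R := Rsum (indicator P) l.

Lemma indicator_bounds {A} (P : A -> Prop) x : 0 <= indicator P x <= 1.
Proof. unfold indicator. destruct excluded_middle_informative; lra. Qed.

Lemma indicator_true {A} (P : A -> Prop) x : P x -> indicator P x = 1.
Proof. intros H. unfold indicator. destruct excluded_middle_informative; tauto. Qed.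

Lemma indicator_false {A} (P : A -> Prop) x : ~ P x -> indicator P x = 0.
Proof. intros H. unfold indicator. destruct excluded_middle_informative; tauto. Qed.

Lemma count_nonneg {A} (P : A -> Prop) l : 0 <= count P l.
Proof. apply Rsum_nonneg. intros x _. apply indicator_bounds. Qed.

Lemma count_subset_union {A} (P Q1 Q2 : A -> Prop) l :
  (forall x, In x l -> P x -> Q1 x \/ Q2 x) -> count P l <= count Q1 l + count Q2 l.
Proof.
  intros H. unfold count. rewrite <- Rsum_plus. apply Rsum_le. intros x Hx.
  specialize (H x Hx). unfold indicator.
  repeat destruct excluded_middle_informative; tauto || lra.
Qed.

Lemma count_subset {A} (P Q : A -> Prop) l :
  (forall x, In x l -> P x -> Q x) -> count P l <= count Q l.
Proof.
  intros H. apply Rsum_le. intros x Hx.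
  specialize (H x Hx). unfold indicator.
  repeat destruct excluded_middle_informative; tauto || lra.
Qed.

Lemma count_all {A} (P : A -> Prop) l :
  (forall x, In x l -> P x) -> count P l = INR (length l).
Proof.
  intros H. rewrite <- (Rmult_1_r (INR (length l))), <- Rsum_const.
  apply Rsum_ext. intros x Hx. now apply indicator_true, H.
Qed.

Lemma count_none {A} (P : A -> Prop) l : (forall x, In x l -> ~ P x) -> count P l = 0.
Proof.
  intros H. rewrite <- (Rmult_0_r (INR (length l))), <- Rsum_const.
  apply Rsum_ext. intros x Hx. now apply indicator_false, H.
Qed.

Lemma count_pos_exists {A} (P : A -> Prop) l : 0 < count P l -> exists x, In x l /\ P x.
Proof.
  intros H. apply NNPP. intros Hn. rewrite count_none in H; [lra|].
  intros x Hx HP. apply Hn. now exists x.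
Qed.

Lemma count_exists_le {A B} (Q : B -> A -> Prop) (ks : list B) l :
  count (fun x => exists k, In k ks /\ Q k x) l <= Rsum (fun k => count (Q k) l) ks.
Proof.
  induction ks as [|k0 ks IH].
  - rewrite count_none; [apply Rle_refl|]. now intros x _ (k & [] & _).
  - rewrite Rsum_cons. eapply Rle_trans; [|apply Rplus_le_compat_l, IH].
    apply count_subset_union. intros x _ (k & [->|Hk] & HQ); [now left | right; eauto].
Qed.

Lemma finitely_many_witnesses {A} (Q : nat -> A -> Prop) (l : list A) :
  exists F, forall x, In x l -> (exists k, Q k x) -> exists k, In k (seq 0 F) /\ Q k x.
Proof.
  induction l as [|y l [F IH]]; [now exists O|].
  destruct (classic (exists k, Q k y)) as [[k Hk]|Hn].
  - exists (Nat.max F (S k)). intros x [<-|Hx] Hex.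
    + exists k. rewrite in_seq. split; [lia | assumption].
    + destruct (IH x Hx Hex) as (k' & Hk' & HQ). exists k'. rewrite in_seq in *.
      split; [lia | assumption].
  - exists F. intros x [<-|Hx] Hex; [contradiction | auto].
Qed.

Lemma count_exists_le_of_series {A} (Q : nat -> A -> Prop) (w : nat -> R) M l :
  (forall k, count (Q k) l <= w k) -> (forall F, Rsum w (seq 0 F) <= M) ->
  count (fun x => exists k, Q k x) l <= M.
Proof.
  intros Hw HM. destruct (finitely_many_witnesses Q l) as [F HF].
  eapply Rle_trans; [apply (count_subset _ _ _ HF)|].
  eapply Rle_trans; [apply count_exists_le|].
  eapply Rle_trans; [apply Rsum_le; intros k _; apply Hw | apply HM].
Qed.

Lemma count_le_of_upper_bound (P : nat -> Prop) v a n :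
  INR a <= v + 1 -> (forall i, In i (seq a n) -> P i -> INR i <= v) ->
  count P (seq a n) <= v - INR a + 1.
Proof.
  revert a. induction n as [|n IH]; intros a Ha HP; [unfold count, Rsum; simpl; lra|].
  destruct (Rle_lt_dec (INR a) v) as [Hav|Hva].
  - pose proof (indicator_bounds P a). rewrite <- cons_seq. unfold count in *.
    rewrite Rsum_cons. specialize (IH (S a)). rewrite S_INR in IH.
    enough (Rsum (indicator P) (seq (S a) n) <= v - (INR a + 1) + 1) by lra.
    apply IH; [lra|]. intros i Hi. apply HP. rewrite in_seq in *. lia.
  - rewrite count_none; [lra|]. intros i Hi HPi. specialize (HP i Hi HPi).
    apply in_seq in Hi as [Hi _]. apply le_INR in Hi. lra.
Qed.

Lemma count_le_of_diameter (P : nat -> Prop) w a n :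
  0 <= w -> (forall i j, P i -> P j -> INR i - INR j <= w) ->
  count P (seq a n) <= w + 1.
Proof.
  intros Hw HP. revert a. induction n as [|n IH]; intros a; [unfold count, Rsum; simpl; lra|].
  destruct (classic (P a)) as [Ha|Ha].
  - replace (w + 1) with (INR a + w - INR a + 1) by ring.
    apply count_le_of_upper_bound; [lra|]. intros i _ Hi. specialize (HP i a Hi Ha). lra.
  - rewrite <- cons_seq. unfold count. rewrite Rsum_cons, indicator_false by assumption.
    rewrite Rplus_0_l. apply IH.
Qed.

Lemma count_in_blocks (P : nat -> Prop) K D :
  count (fun i => P (i / D)%nat) (seq 0 (K * D)) = INR D * count P (seq 0 K).
Proof.
  unfold count. rewrite seq_mult_flat_map, Rsum_flat_map, <- Rsum_scal_l.
  apply Rsum_ext. intros J _.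
  rewrite Rsum_ext with (g := fun _ => indicator P J).
  - rewrite Rsum_const, length_seq. reflexivity.
  - intros i Hi. unfold indicator. now rewrite (div_in_block _ _ _ Hi).
Qed.

Lemma count_guarded_le {A B} (P : B -> Prop) (Q : A -> Prop) k b l :
  (P k -> count Q l <= b) -> count (fun x => P k /\ Q x) l <= b * indicator P k.
Proof.
  intros H. destruct (classic (P k)) as [Hk|Hk].
  - rewrite indicator_true, Rmult_1_r by assumption.
    apply Rle_trans with (2 := H Hk), count_subset. tauto.
  - rewrite indicator_false, Rmult_0_r by assumption. apply Req_le, count_none. tauto.
Qed.

Lemma count_in_blocks_and_le (P Q : nat -> Prop) K D B :
  (forall J, P J -> count Q (seq (J * D) D) <= B) ->
  count (fun i => P (i / D)%nat /\ Q i) (seq 0 (K * D)) <= B * count P (seq 0 K).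
Proof.
  intros H. unfold count at 1. rewrite seq_mult_flat_map, Rsum_flat_map.
  unfold count. rewrite <- Rsum_scal_l. apply Rsum_le. intros J _.
  apply Rle_trans with (count (fun i => P J /\ Q i) (seq (J * D) D)).
  - apply count_subset. intros i Hi. now rewrite (div_in_block _ _ _ Hi).
  - apply count_guarded_le, H.
Qed.

Lemma count_exists_and_le {A} (P : nat -> Prop) (Q : nat -> A -> Prop) b M l :
  0 <= b -> (forall k, P k -> count (Q k) l <= b) -> (forall F, count P (seq 0 F) <= M) ->
  count (fun x => exists k, P k /\ Q k x) l <= b * M.
Proof.
  intros Hb HQ HP. apply count_exists_le_of_series with (w := fun k => b * indicator P k).
  - intros k. apply count_guarded_le, HQ.
  - intros F. rewrite Rsum_scal_l. apply Rmult_le_compat_l; [assumption | apply HP].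
Qed.

(** * Dyadic atoms *)

Lemma pow2_pos n : 0 < 2 ^ n.
Proof. apply pow_lt. lra. Qed.

Lemma INR_pow2 n : INR (2 ^ n) = 2 ^ n.
Proof. now rewrite pow_INR. Qed.

Definition density (P : nat -> Prop) (n : nat) : R := count P (seq 0 (2 ^ n)) / 2 ^ n.

Lemma density_nonneg P n : 0 <= density P n.
Proof.
  apply Rle_div_r; [apply pow2_pos|]. rewrite Rmult_0_l. apply count_nonneg.
Qed.

Lemma density_subset_union (P Q1 Q2 : nat -> Prop) n :
  (forall i, P i -> Q1 i \/ Q2 i) -> density P n <= density Q1 n + density Q2 n.
Proof.
  intros H. unfold density, Rdiv. rewrite <- Rmult_plus_distr_r.
  apply Rmult_le_compat_r; [left; apply Rinv_0_lt_compat, pow2_pos|].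
  apply count_subset_union. auto.
Qed.

Lemma density_all (P : nat -> Prop) n : (forall i, P i) -> density P n = 1.
Proof.
  intros H. unfold density. rewrite count_all by auto.
  rewrite length_seq, INR_pow2. pose proof (pow2_pos n). field. lra.
Qed.

Lemma density_ancestor (P : nat -> Prop) n e :
  density (fun i => P (i / 2 ^ e)%nat) (n + e) = density P n.
Proof.
  unfold density. rewrite Nat.pow_add_r, count_in_blocks, INR_pow2, pow_add.
  pose proof (pow2_pos n). pose proof (pow2_pos e). field. lra.
Qed.

Lemma density_ancestor_and_le (P Q : nat -> Prop) n e B :
  (forall J, P J -> count Q (seq (J * 2 ^ e) (2 ^ e)) <= B * 2 ^ e) ->
  density (fun i => P (i / 2 ^ e)%nat /\ Q i) (n + e) <= B * density P n.
Proof.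
  intros H. unfold density. pose proof (pow2_pos n). pose proof (pow2_pos e).
  apply Rle_div_l; [apply pow2_pos|].
  rewrite Nat.pow_add_r. eapply Rle_trans; [apply count_in_blocks_and_le, H|].
  rewrite pow_add. apply Req_le. field. lra.
Qed.

Definition atom (n i : nat) (x : R) : Prop := INR i <= x * 2 ^ n <= INR i + 1.

Definition meets (n : nat) (V : R -> Prop) (i : nat) : Prop := exists x, atom n i x /\ V x.

Lemma atom_ancestor n e i x : atom (n + e) i x -> atom n (i / 2 ^ e) x.
Proof.
  unfold atom. rewrite pow_add. intros [Hl Hu].
  assert (HD : (2 ^ e <> 0)%nat) by now apply Nat.pow_nonzero.
  pose proof (Nat.div_mod i _ HD) as Hi. pose proof (Nat.mod_upper_bound i _ HD).
  set (m := (i / 2 ^ e)%nat) in *. pose proof (pow2_pos e).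
  assert (Hm1 : INR m * 2 ^ e <= INR i).
  { rewrite <- INR_pow2, <- mult_INR. apply le_INR. lia. }
  assert (Hm2 : INR i + 1 <= (INR m + 1) * 2 ^ e).
  { rewrite <- INR_pow2, <- !S_INR, <- mult_INR. apply le_INR. lia. }
  split; apply Rmult_le_reg_r with (2 ^ e); lra.
Qed.

Lemma count_meets_le (V : R -> Prop) d N a n :
  1 <= d * 2 ^ N -> (forall x y, V x -> V y -> Rabs (x - y) <= d) ->
  count (meets N V) (seq a n) <= 3 * d * 2 ^ N.
Proof.
  intros Hd Hdiam. pose proof (pow2_pos N).
  apply Rle_trans with (d * 2 ^ N + 1 + 1); [|lra].
  apply count_le_of_diameter; [lra|]. intros i j (x & Hx & HVx) (y & Hy & HVy).
  pose proof (Rle_trans _ _ _ (Rle_abs _) (Hdiam x y HVx HVy)) as Hxy.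
  apply Rmult_le_compat_r with (r := 2 ^ N) in Hxy; [|lra].
  unfold atom in *. lra.
Qed.

(** * Nested removal *)

Lemma closed_atom n i : closed (atom n i).
Proof.
  assert (Hscale : forall x : R, continuous (fun y => y * 2 ^ n) x).
  { intros x. apply (continuous_mult (fun y => y) (fun _ => 2 ^ n));
      [apply continuous_id | apply continuous_const]. }
  apply closed_and.
  - exact (closed_comp _ _ Hscale (closed_ge (INR i))).
  - exact (closed_comp _ _ Hscale (closed_le (INR i + 1))).
Qed.

Lemma closed_exists_lt {T : UniformSpace} (F : nat -> T -> Prop) n :
  (forall i, closed (F i)) -> closed (fun x => exists i, (i < n)%nat /\ F i x).
Proof.
  intros HF. induction n as [|n IH]; intros x Hx; apply NNPP; intros Hn; apply Hx.
  - apply filter_forall. intros y (i & Hi & _). lia.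
  - assert (Hprev : locally x (fun y => ~ exists i, (i < n)%nat /\ F i y)).
    { apply NNPP. intros H. destruct (IH x H) as (i & Hi & HFi). apply Hn. exists i. auto. }
    assert (Hlast : locally x (fun y => ~ F n y)).
    { apply NNPP. intros H. apply Hn. exists n. split; [lia | now apply (HF n)]. }
    generalize (filter_and _ _ Hprev Hlast). apply filter_imp.
    intros y [Hy Hyn] (i & Hi & HFi).
    destruct (Nat.eq_dec i n) as [->|]; [contradiction|].
    apply Hy. exists i. split; [lia | assumption].
Qed.

Lemma closed_decreasing_intersection (K : nat -> R -> Prop) a b :
  (forall j, closed (K j)) -> (forall j x, K (S j) x -> K j x) ->
  (forall j, exists x, a <= x <= b /\ K j x) ->
  exists x, forall j, K j x.
Proof.
  intros Hclosed Hdecr Hne.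
  assert (Hmono : forall j k x, (j <= k)%nat -> K k x -> K j x).
  { intros j k x Hjk. induction Hjk as [|k _ IH]; auto. }
  set (u := fun j => proj1_sig (constructive_indefinite_description _ (Hne j))).
  assert (Hu : forall j, a <= u j <= b /\ K j (u j)).
  { intros j. unfold u. now destruct constructive_indefinite_description. }
  destruct (Bolzano_Weierstrass u _ (compact_P3 a b)) as [x Hx]; [apply Hu|].
  exists x. intros j. apply Hclosed. intros [eps Heps].
  destruct (Hx (fun y => ~ K j y) j) as (k & Hjk & Hk).
  - exists eps. exact Heps.
  - apply Hk, (Hmono j k); [assumption | apply Hu].
Qed.

Section NestedRemoval.

Variables (level : nat -> nat) (removed : nat -> R -> Prop).
Hypothesis level_incr : forall j, (level j <= level (S j))%nat.

Fixpoint survives (j i : nat) : Prop :=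
  match j with
  | O => True
  | S k => survives k (i / 2 ^ (level (S k) - level k))%nat
           /\ ~ meets (level (S k)) (removed (S k)) i
  end.

Definition surviving_set (j : nat) (x : R) : Prop :=
  exists i, (i < 2 ^ level j)%nat /\ (survives j i /\ atom (level j) i x).

Lemma closed_surviving_set j : closed (surviving_set j).
Proof.
  apply closed_exists_lt. intros i. apply closed_and; [|apply closed_atom].
  intros x Hx. apply NNPP. intros Hn. apply Hx, filter_forall. auto.
Qed.

Lemma surviving_set_decreasing j x : surviving_set (S j) x -> surviving_set j x.
Proof.
  intros (i & Hi & [Hs _] & Hx). exists (i / 2 ^ (level (S j) - level j))%nat.
  replace (level (S j)) with (level j + (level (S j) - level j))%nat in Hi, Hx
    by (specialize (level_incr j); lia).
  split; [|split].
  - apply Nat.Div0.div_lt_upper_bound. now rewrite Nat.mul_comm, <- Nat.pow_add_r.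
  - exact Hs.
  - apply atom_ancestor, Hx.
Qed.

Lemma exists_never_removed :
  (forall j, 0 < density (survives j) (level j)) ->
  exists x, forall j, ~ removed (S j) x.
Proof.
  intros Hpos. destruct (closed_decreasing_intersection surviving_set 0 1) as [x Hx].
  - exact closed_surviving_set.
  - exact surviving_set_decreasing.
  - intros j. pose proof (pow2_pos (level j)). specialize (Hpos j).
    apply Rlt_div_r in Hpos; [|assumption]. rewrite Rmult_0_l in Hpos.
    destruct (count_pos_exists _ _ Hpos) as (i & Hi & Hs). apply in_seq in Hi as [_ Hi].
    exists (INR i / 2 ^ level j).
    assert (Hscale : INR i / 2 ^ level j * 2 ^ level j = INR i) by (field; lra).
    split.
    + apply lt_INR in Hi. simpl in Hi. rewrite INR_pow2 in Hi. split.
      * apply Rle_div_r; [assumption|]. rewrite Rmult_0_l. apply pos_INR.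
      * apply Rle_div_l; lra.
    + exists i. split; [exact Hi|]. split; [exact Hs|]. unfold atom. lra.
  - exists x. intros j Hj. destruct (Hx (S j)) as (i & _ & [_ Hi] & Hatom).
    apply Hi. now exists x.
Qed.

End NestedRemoval.

(** * The Peres-Schlag scheme *)

Lemma dist_nint_lt_nat x c : 0 <= x -> dist_nint x < c -> exists r, Rabs (x - INR r) < c.
Proof.
  intros Hx Hc. destruct (base_Int_part x) as [Hl Hu].
  assert (Hz : (0 <= Int_part x)%Z).
  { assert (IZR (-1) < IZR (Int_part x)) as H by lra. apply lt_IZR in H. lia. }
  unfold dist_nint, Rmin in Hc. destruct Rle_dec.
  - exists (Z.to_nat (Int_part x)). rewrite INR_IZR_INZ, Z2Nat.id by assumption.
    rewrite Rabs_pos_eq; lra.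
  - exists (Z.to_nat (Int_part x + 1)). rewrite INR_IZR_INZ, Z2Nat.id, plus_IZR by lia.
    rewrite Rabs_left1; lra.
Qed.

Definition near_fraction (t c : R) (r : nat) (x : R) : Prop := Rabs (t * x - INR r) < c.

Lemma count_fractions_near_atom t c n J F :
  2 ^ n <= t -> c <= / 2 ->
  count (fun r => meets n (near_fraction t c r) J) (seq 0 F) <= 3 * (t / 2 ^ n).
Proof.
  intros Ht Hc. pose proof (pow2_pos n).
  assert (Hratio : 1 <= t / 2 ^ n) by (apply Rle_div_r; lra).
  apply Rle_trans with (t / 2 ^ n + 1 + 1); [|lra].
  apply count_le_of_diameter; [lra|]. intros r r' (x & Hx & Hr) (y & Hy & Hr').
  apply Rabs_def2 in Hr, Hr'.
  assert (Hxy : x - y <= 1 / 2 ^ n) by (apply Rle_div_r; [|unfold atom in *]; lra).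
  apply Rmult_le_compat_l with (r := t) in Hxy; [|lra].
  unfold Rdiv in *. lra.
Qed.

Lemma count_meets_near_fraction_le t c r N a n :
  0 < t -> t <= c * 2 ^ N ->
  count (meets N (near_fraction t c r)) (seq a n) <= 6 * (c / t) * 2 ^ N.
Proof.
  intros Ht Hc. pose proof (pow2_pos N).
  assert (Hct : 1 <= c / t * 2 ^ N).
  { replace (c / t * 2 ^ N) with (c * 2 ^ N / t) by (field; lra). apply Rle_div_r; lra. }
  replace (6 * (c / t)) with (3 * (2 * (c / t))) by ring.
  apply count_meets_le; [lra|]. intros x y Hx Hy.
  assert (Hinterval : forall z, near_fraction t c r z ->
    (INR r - c) / t <= z <= (INR r + c) / t).
  { intros z Hz. apply Rabs_def2 in Hz.
    split; [apply Rle_div_l | apply Rle_div_r]; lra. }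
  apply Hinterval in Hx, Hy.
  assert ((INR r + c) / t - (INR r - c) / t = 2 * (c / t)) by (field; lra).
  apply Rabs_le. lra.
Qed.

Lemma count_meets_near_fractions_le t c n e J :
  2 ^ n <= t -> c <= / 2 -> t <= c * 2 ^ (n + e) ->
  count (meets (n + e) (fun x => dist_nint (t * x) < c)) (seq (J * 2 ^ e) (2 ^ e))
    <= 18 * c * 2 ^ e.
Proof.
  intros Ht Hc Hlow. pose proof (pow2_pos n). pose proof (pow2_pos (n + e)).
  assert (Hc0 : 0 <= c / t) by (apply Rle_div_r; nra).
  replace (18 * c * 2 ^ e) with (6 * (c / t) * 2 ^ (n + e) * (3 * (t / 2 ^ n)))
    by (rewrite pow_add; field; lra).
  eapply Rle_trans; [|apply count_exists_and_le with
    (P := fun r => meets n (near_fraction t c r) J)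
    (Q := fun r => meets (n + e) (near_fraction t c r))].
  - apply count_subset. intros i Hi (x & Hx & Hdist).
    assert (HJ : atom n J x).
    { rewrite <- (div_in_block _ _ _ Hi). now apply atom_ancestor. }
    assert (Hx0 : 0 <= x).
    { destruct HJ as [HJ _]. pose proof (pos_INR J). nra. }
    destruct (dist_nint_lt_nat (t * x) c) as [r Hr]; [nra | assumption |].
    exists r. split; exists x; auto.
  - nra.
  - intros r _. apply count_meets_near_fraction_le; lra.
  - intros F. now apply count_fractions_near_atom.
Qed.

Definition dyadic_range (m n : nat) : list nat := seq (2 ^ m) (2 ^ n - 2 ^ m).

Lemma in_dyadic_range m n q : In q (dyadic_range m n) <-> (2 ^ m <= q < 2 ^ n)%nat.
Proof. unfold dyadic_range. rewrite in_seq. lia. Qed.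

Definition well_approximated (psi : nat -> R) (m n : nat) (x : R) : Prop :=
  exists q, In q (dyadic_range m n) /\ dist_nint (INR q * x) < psi q.

Lemma density_meets_well_approximated psi (P : nat -> Prop) m n e :
  (forall q, In q (dyadic_range n m) -> psi q <= / 2 /\ INR q <= psi q * 2 ^ (n + e)) ->
  density (fun i => P (i / 2 ^ e)%nat /\ meets (n + e) (well_approximated psi n m) i) (n + e)
    <= 18 * Rsum psi (dyadic_range n m) * density P n.
Proof.
  intros Hpsi. apply density_ancestor_and_le. intros J _.
  eapply Rle_trans; [apply count_subset with (Q := fun i => exists q,
    In q (dyadic_range n m) /\ meets (n + e) (fun x => dist_nint (INR q * x) < psi q) i)|].
  - intros i _ (x & Hx & q & Hq & Hdist). exists q. split; [assumption | now exists x].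
  - eapply Rle_trans; [apply count_exists_le|].
    rewrite <- Rsum_scal_l, Rmult_comm, <- Rsum_scal_l. apply Rsum_le. intros q Hq.
    rewrite (Rmult_comm (2 ^ e)). destruct (Hpsi q Hq).
    apply count_meets_near_fractions_le; [|assumption..].
    apply in_dyadic_range in Hq as [Hq _]. rewrite <- INR_pow2. now apply le_INR.
Qed.

Definition covered_at_scale (U : nat -> R -> Prop) (d : nat -> R) (m n : nat) (x : R) : Prop :=
  exists k, d k * 2 ^ m < 1 <= d k * 2 ^ n /\ U k x.

Lemma density_meets_covered_at_scale (U : nat -> R -> Prop) d s m n :
  s <= 1 -> (forall k, 0 < d k) ->
  (forall k x y, U k x -> U k y -> Rabs (x - y) <= d k) ->
  (forall F, Rsum (fun k => Rpower (d k) s) (seq 0 F) <= 1) ->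
  density (meets n (covered_at_scale U d m n)) n <= 3 * Rpower (/ 2 ^ m) (1 - s).
Proof.
  intros Hs Hd Hdiam Hsum. pose proof (pow2_pos m). pose proof (pow2_pos n).
  apply Rle_div_l; [assumption|].
  set (b := 3 * Rpower (/ 2 ^ m) (1 - s) * 2 ^ n).
  assert (Hb : 0 <= b).
  { unfold b. assert (0 < Rpower (/ 2 ^ m) (1 - s)) by apply exp_pos. nra. }
  eapply Rle_trans; [apply count_subset with (Q := fun i => exists k,
    d k * 2 ^ m < 1 <= d k * 2 ^ n /\ meets n (U k) i)|].
  { intros i _ (x & Hx & k & Hk & HU). exists k. split; [assumption | now exists x]. }
  apply count_exists_le_of_series with (w := fun k => b * Rpower (d k) s).
  - intros k. assert (Hpow : 0 < Rpower (d k) s) by apply exp_pos.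
    destruct (classic (d k * 2 ^ m < 1 <= d k * 2 ^ n)) as [[Hm Hn]|Hk].
    + apply Rle_trans with (3 * d k * 2 ^ n).
      { eapply Rle_trans; [|apply (count_meets_le (U k)); [exact Hn | apply Hdiam]].
        apply count_subset. tauto. }
      assert (Hsplit : d k = Rpower (d k) s * Rpower (d k) (1 - s)).
      { rewrite <- Rpower_plus, Rplus_minus, Rpower_1; auto. }
      assert (Hsmall : Rpower (d k) (1 - s) <= Rpower (/ 2 ^ m) (1 - s)).
      { apply Rle_Rpower_l; [lra|]. split; [apply Hd|].
        rewrite <- Rdiv_1_l. apply Rle_div_r; lra. }
      rewrite Hsplit at 1. unfold b.
      apply Rmult_le_compat_l with (r := 3 * Rpower (d k) s * 2 ^ n) in Hsmall; nra.
    + rewrite count_none; [nra|]. tauto.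
  - intros F. rewrite Rsum_scal_l. specialize (Hsum F). nra.
Qed.

(* The lower bound makes the intervals removed for [2^N <= q < 2^(5 N)] longer than the atoms
   of level [25 N]. *)
Definition admissible_radii (psi : nat -> R) (N0 : nat) : Prop :=
  (forall q, (2 ^ N0 <= q)%nat -> psi q <= / 2 /\ 1 <= psi q * INR q ^ 4) /\
  (forall N, (N0 <= N)%nat -> Rsum psi (dyadic_range N (5 * N)) <= / 144).

Lemma admissible_radii_mono psi N0 N1 :
  (N0 <= N1)%nat -> admissible_radii psi N0 -> admissible_radii psi N1.
Proof.
  intros HN [Hpsi Hsum]. split.
  - intros q Hq. apply Hpsi. apply Nat.le_trans with (2 := Hq), Nat.pow_le_mono_r; lia.
  - intros N HN1. apply Hsum. lia.
Qed.

Lemma admissible_radii_lower psi N0 l q :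
  admissible_radii psi N0 -> (N0 <= l)%nat -> In q (dyadic_range l (5 * l)) ->
  psi q <= / 2 /\ INR q <= psi q * 2 ^ (5 * (5 * l)).
Proof.
  intros [Hpsi _] Hl Hq. apply in_dyadic_range in Hq as [Hlq Hq].
  destruct (Hpsi q) as [Hhalf Hlow].
  { apply Nat.le_trans with (2 := Hlq), Nat.pow_le_mono_r; lia. }
  split; [assumption|].
  assert (Hq1 : 1 <= INR q).
  { apply (le_INR 1). assert (2 ^ l <> 0)%nat by now apply Nat.pow_nonzero. lia. }
  assert (Hq5 : INR q ^ 5 <= 2 ^ (5 * (5 * l))).
  { rewrite (Nat.mul_comm 5), pow_mult. apply pow_incr. split; [lra|].
    rewrite <- INR_pow2. apply le_INR. lia. }
  assert (Hq4 : 0 < INR q ^ 4) by (apply pow_lt; lra).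
  assert (Hpos : 0 < psi q) by nra.
  apply Rle_trans with (psi q * INR q ^ 5); [|apply Rmult_le_compat_l; lra].
  replace (psi q * INR q ^ 5) with (INR q * (psi q * INR q ^ 4)) by ring. nra.
Qed.

Lemma pow_half_le_of_recurrence (b : nat -> R) :
  b 0%nat = 1 -> b 1%nat = 1 ->
  (forall j, b (S j) - / 8 * b j - / 4 * / 2 ^ S j <= b (S (S j))) ->
  forall j, / 2 ^ j <= b j.
Proof.
  intros Hb0 Hb1 Hrec.
  cut (forall j, b j / 2 <= b (S j) /\ / 2 ^ j <= b j); [intros Hb j; apply Hb|].
  induction j as [|j [IHratio IHpow]]; [rewrite Hb0, Hb1; simpl; lra|].
  assert (/ 2 ^ S j <= b (S j)) by (simpl; rewrite Rinv_mult; lra).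
  specialize (Hrec j). split; lra.
Qed.

Lemma exists_crossing (P : nat -> Prop) n :
  ~ P O -> P n -> exists j, ~ P j /\ P (S j).
Proof.
  intros H0. induction n as [|n IH]; intros Hn; [contradiction|].
  destruct (classic (P n)); [auto | now exists n].
Qed.

Section Avoidance.

Variables (psi : nat -> R) (N0 : nat) (U : nat -> R -> Prop) (d : nat -> R) (s : R).
Hypothesis psi_admissible : admissible_radii psi N0.
Hypothesis N0_large : 4 <= (1 - s) * INR N0.
Hypothesis d_pos : forall k, 0 < d k.
Hypothesis d_small : forall k, d k * 2 ^ (5 * N0) < 1.
Hypothesis U_diameter : forall k x y, U k x -> U k y -> Rabs (x - y) <= d k.
Hypothesis d_sum : forall F, Rsum (fun k => Rpower (d k) s) (seq 0 F) <= 1.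

Definition stage_level (j : nat) : nat := (N0 * 5 ^ j)%nat.

Definition stage_removal (j : nat) (x : R) : Prop :=
  match j with
  | S (S k) => well_approximated psi (stage_level k) (stage_level (S k)) x
               \/ covered_at_scale U d (stage_level (S k)) (stage_level (S (S k))) x
  | _ => False
  end.

Definition surviving_density (j : nat) : R :=
  density (survives stage_level stage_removal j) (stage_level j).

Lemma stage_level_S j : stage_level (S j) = (5 * stage_level j)%nat.
Proof. unfold stage_level. simpl. lia. Qed.

Lemma stage_level_ge j : (N0 * S j <= stage_level j)%nat.
Proof. unfold stage_level. apply Nat.mul_le_mono_l, Nat.pow_gt_lin_r. lia. Qed.

Lemma s_lt_1 : s < 1.
Proof. pose proof (pos_INR N0). nra. Qed.

Lemma N0_pos : (0 < N0)%nat.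
Proof. pose proof s_lt_1. apply INR_lt. simpl. nra. Qed.

Lemma pow_stage_level_gt n : INR n < 2 ^ stage_level n.
Proof.
  rewrite <- INR_pow2. apply lt_INR.
  apply Nat.lt_le_trans with (2 ^ n)%nat; [apply Nat.pow_gt_lin_r; lia|].
  apply Nat.pow_le_mono_r; [lia|]. pose proof (stage_level_ge n). pose proof N0_pos. nia.
Qed.

Lemma survives_child_or_removed j i :
  let l := stage_level in
  survives l stage_removal (S j) (i / 2 ^ (l (S (S j)) - l (S j))) ->
  survives l stage_removal (S (S j)) i \/
  ((survives l stage_removal j (i / 2 ^ (l (S (S j)) - l j)) /\
    meets (l (S (S j))) (well_approximated psi (l j) (l (S j))) i) \/
   meets (l (S (S j))) (covered_at_scale U d (l (S j)) (l (S (S j)))) i).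
Proof.
  intros l Hparent.
  destruct (classic (meets (l (S (S j))) (stage_removal (S (S j))) i)) as [Hmeets|Hn];
    [right | now left].
  destruct Hmeets as (x & Hx & [Happ|Hcov]); [left | right; now exists x].
  split; [|now exists x].
  destruct Hparent as [Hgrand _].
  pose proof (stage_level_S j) as Hl1. pose proof (stage_level_S (S j)) as Hl2.
  fold l in Hl1, Hl2.
  rewrite Nat.Div0.div_div, <- Nat.pow_add_r in Hgrand.
  now replace (l (S (S j)) - l (S j) + (l (S j) - l j))%nat
    with (l (S (S j)) - l j)%nat in Hgrand by lia.
Qed.

(* The denominators handled at stage [j + 2] are equidistributed at the scale of stage [j],
   so what happened at stage [j + 1] is irrelevant to them. *)
Lemma surviving_density_step j :
  surviving_density (S j) - / 8 * surviving_density j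
    - 3 * Rpower (/ 2 ^ stage_level (S j)) (1 - s) <= surviving_density (S (S j)).
Proof.
  pose proof (survives_child_or_removed j) as Hsplit. cbv zeta in Hsplit.
  unfold surviving_density. set (A := survives stage_level stage_removal) in *.
  pose proof (stage_level_S j) as Hl1. pose proof (stage_level_S (S j)) as Hl2.
  pose proof (stage_level_ge j) as HN0.
  set (l0 := stage_level j) in *. set (l1 := stage_level (S j)) in *.
  set (l2 := stage_level (S (S j))) in *.
  set (e := (l2 - l0)%nat) in *. assert (Hl0 : (l0 + e = l2)%nat) by (unfold e; lia).
  set (cover := meets l2 (covered_at_scale U d l1 l2)) in *.
  assert (Hcover : density cover l2 <= 3 * Rpower (/ 2 ^ l1) (1 - s))
    by (pose proof s_lt_1; apply density_meets_covered_at_scale; auto; lra).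
  set (approx := fun i => A j (i / 2 ^ e)%nat /\ meets l2 (well_approximated psi l0 l1) i).
  assert (Happrox : density approx l2 <= / 8 * density (A j) l0).
  { unfold approx. rewrite <- Hl0. destruct psi_admissible as [_ Hsum].
    eapply Rle_trans; [apply density_meets_well_approximated|].
    - intros q Hq. rewrite Hl0, Hl2, Hl1. rewrite Hl1 in Hq.
      apply (admissible_radii_lower psi N0); [assumption | lia | assumption].
    - specialize (Hsum l0 ltac:(lia)). rewrite <- Hl1 in Hsum.
      apply Rmult_le_compat_r; [apply density_nonneg | lra]. }
  pose proof (density_subset_union _ _ _ l2 Hsplit) as Hstep.
  pose proof (density_subset_union (fun i => approx i \/ cover i) approx cover l2 ltac:(auto))
    as Hremoved.
  pose proof (density_ancestor (A (S j)) l1 (l2 - l1)) as Hparent.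
  replace (l1 + (l2 - l1))%nat with l2 in Hparent by lia.
  unfold approx in *. lra.
Qed.

Lemma cover_loss_le j :
  3 * Rpower (/ 2 ^ stage_level (S j)) (1 - s) <= / 4 * / 2 ^ S j.
Proof.
  rewrite <- Rpower_pow, <- Rpower_Ropp, Rpower_mult by lra.
  apply Rle_trans with (3 * Rpower 2 (- INR (S j + 4))).
  - apply Rmult_le_compat_l; [lra|]. apply Rle_Rpower; [lra|].
    pose proof (le_INR _ _ (stage_level_ge (S j))) as Hlevel.
    rewrite mult_INR in Hlevel. rewrite plus_INR. rewrite !S_INR in *. simpl (INR 0).
    pose proof (pos_INR j). pose proof s_lt_1.
    apply Rmult_le_compat_l with (r := 1 - s) in Hlevel; nra.
  - rewrite Rpower_Ropp, Rpower_pow, pow_add, Rinv_mult by lra.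
    assert (0 < / 2 ^ S j) by apply Rinv_0_lt_compat, pow2_pos. lra.
Qed.

Lemma surviving_density_lower j : / 2 ^ j <= surviving_density j.
Proof.
  revert j. apply pow_half_le_of_recurrence.
  - now apply density_all.
  - apply density_all. intros i. split; [exact I|]. now intros (x & _ & Hx).
  - intros j. pose proof (surviving_density_step j). pose proof (cover_loss_le j). lra.
Qed.

Lemma exists_avoiding_point :
  exists x, (forall q, (2 ^ N0 <= q)%nat -> psi q <= dist_nint (INR q * x))
            /\ forall k, ~ U k x.
Proof.
  destruct (exists_never_removed stage_level stage_removal) as [x Hx].
  - intros j. rewrite stage_level_S. lia.
  - intros j. apply Rlt_le_trans with (2 := surviving_density_lower j).
    apply Rinv_0_lt_compat, pow2_pos.
  - assert (Hlevel0 : stage_level 0 = N0) by (unfold stage_level; simpl; lia).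
    exists x. split.
    + intros q Hq. apply Rnot_lt_le. intros Hdist.
      destruct (exists_crossing (fun j => q < 2 ^ stage_level j)%nat q) as (j & Hj & HSj).
      * rewrite Hlevel0. lia.
      * apply INR_lt. rewrite INR_pow2. apply pow_stage_level_gt.
      * apply (Hx (S j)). left. exists q. rewrite in_dyadic_range. split; [lia | assumption].
    + intros k HU. destruct (INR_archimed (d k) 1 (d_pos k)) as [n Hn].
      destruct (exists_crossing (fun j => 1 <= d k * 2 ^ stage_level (S j)) n)
        as (j & Hj & HSj).
      * rewrite stage_level_S, Hlevel0. specialize (d_small k). lra.
      * pose proof (pow_stage_level_gt (S n)) as Hpow. rewrite S_INR in Hpow.
        specialize (d_pos k). nra.
      * apply (Hx (S j)). right. exists k. repeat split; [lra | assumption..].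
Qed.

End Avoidance.

(** * Power sums *)

Lemma Rsum_telescope_le (f g : nat -> R) a n :
  (forall k, (a <= k)%nat -> f k <= g (S k) - g k) ->
  Rsum f (seq a n) <= g (a + n)%nat - g a.
Proof.
  intros H. induction n as [|n IH].
  - rewrite Nat.add_0_r. unfold Rsum. simpl. lra.
  - rewrite seq_S, Rsum_app, Nat.add_succ_r. unfold Rsum at 2. simpl.
    specialize (H (a + n)%nat ltac:(lia)). lra.
Qed.

Lemma Rsum_pow_half_le F : Rsum (fun k => / 2 ^ S k) (seq 0 F) <= 1.
Proof.
  eapply Rle_trans; [apply Rsum_telescope_le with (g := fun k => - / 2 ^ k)|].
  - intros k _. simpl. rewrite Rinv_mult. lra.
  - pose proof (Rinv_0_lt_compat _ (pow2_pos (0 + F))). simpl in *. lra.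
Qed.

Lemma exp_le x y : x <= y -> exp x <= exp y.
Proof. intros [H| ->]; [left; now apply exp_increasing | apply Rle_refl]. Qed.

Lemma Rpower_le_exponent x y z : 0 < x <= 1 -> y <= z -> Rpower x z <= Rpower x y.
Proof.
  intros Hx Hyz. apply exp_le.
  assert (ln x <= 0) by (rewrite <- ln_1; apply ln_le; lra). nra.
Qed.

Lemma Rpower_le_nonpos_exponent x y z : 0 < x <= y -> z <= 0 -> Rpower y z <= Rpower x z.
Proof.
  intros Hxy Hz. replace z with (- - z) by ring. rewrite !(Rpower_Ropp _ (- z)).
  apply Rinv_le_contravar; [apply exp_pos | apply Rle_Rpower_l; lra].
Qed.

Lemma Rpower_1_l z : Rpower 1 z = 1.
Proof. unfold Rpower. rewrite ln_1, Rmult_0_r. apply exp_0. Qed.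

Lemma Rpower_increment_ge x b :
  0 < x -> b <= 1 -> b <> 0 -> Rpower (x + 1) (b - 1) <= (Rpower (x + 1) b - Rpower x b) / b.
Proof.
  intros Hx Hb Hb0.
  destruct (MVT_cor2 (fun y => Rpower y b) (fun y => b * Rpower y (b - 1)) x (x + 1))
    as (c & -> & Hc); [lra | intros c Hc; apply derivable_pt_lim_power; lra |].
  replace (b * Rpower c (b - 1) * (x + 1 - x) / b) with (Rpower c (b - 1)) by (field; lra).
  apply Rpower_le_nonpos_exponent; lra.
Qed.

Lemma ln_increment_bounds x : 0 < x -> / (x + 1) <= ln (x + 1) - ln x <= / x.
Proof.
  assert (Hln : forall y z, 0 < y -> 0 < z -> ln z - ln y <= (z - y) / y).
  { intros y z Hy Hz. rewrite <- ln_div by assumption.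
    pose proof (exp_ineq1_le (ln (z / y))) as H.
    rewrite exp_ln in H by now apply Rdiv_lt_0_compat.
    replace ((z - y) / y) with (z / y - 1) by (field; lra). lra. }
  intros Hx. split.
  - specialize (Hln (x + 1) x ltac:(lra) Hx).
    replace ((x - (x + 1)) / (x + 1)) with (- / (x + 1)) in Hln by (field; lra). lra.
  - specialize (Hln x (x + 1) Hx ltac:(lra)).
    now replace ((x + 1 - x) / x) with (/ x) in Hln by (field; lra).
Qed.

Lemma Rsum_Rpower_le b n :
  b <= 1 -> b <> 0 -> (1 <= n)%nat ->
  Rsum (fun k => Rpower (INR k) (b - 1)) (seq 1 n) <= 1 + (Rpower (INR n) b - 1) / b.
Proof.
  intros Hb Hb0 Hn. destruct n as [|n]; [lia|].
  rewrite <- cons_seq, Rsum_cons, Rpower_1_l.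
  apply Rplus_le_compat_l. rewrite <- seq_shift, Rsum_map.
  eapply Rle_trans; [apply Rsum_telescope_le with (g := fun k => Rpower (INR k) b / b)|].
  - intros k Hk. rewrite <- RIneq.Rdiv_minus_distr, S_INR.
    apply Rpower_increment_ge; [apply lt_0_INR; lia | assumption..].
  - cbv beta. change (1 + n)%nat with (S n). rewrite Rpower_1_l. lra.
Qed.

Lemma harmonic_sum_le n :
  (1 <= n)%nat -> Rsum (fun k => / INR k) (seq 1 n) <= 1 + ln (INR n).
Proof.
  intros Hn. destruct n as [|n]; [lia|].
  rewrite <- cons_seq, Rsum_cons. simpl (INR 1). rewrite Rinv_1.
  apply Rplus_le_compat_l. rewrite <- seq_shift, Rsum_map.
  eapply Rle_trans; [apply Rsum_telescope_le with (g := fun k => ln (INR k))|].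
  - intros k Hk. rewrite S_INR. apply ln_increment_bounds, lt_0_INR. lia.
  - cbv beta. change (1 + n)%nat with (S n). simpl (INR 1). rewrite ln_1. lra.
Qed.

Lemma ln_INR_bracket y : 0 <= y -> exists m, ln (INR (S m)) <= y <= ln (INR (S (S m))).
Proof.
  intros Hy. destruct (nfloor_ex (exp y)) as [[|m] [Hl Hu]]; [left; apply exp_pos| |].
  - pose proof (exp_ineq1_le y). simpl in Hu. lra.
  - exists m. rewrite <- (ln_exp y). rewrite (S_INR (S m)).
    assert (0 < INR (S m)) by (apply lt_0_INR; lia).
    split; apply ln_le; try apply exp_pos; lra.
Qed.

(** * Hausdorff dimension *)

(* The points [(kappa / 2) ln m] and their opposites cut the line into intervals of length
   at most [kappa / (2 m)]. *)
Lemma harmonic_cover_of_line kappa :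
  0 < kappa ->
  exists U : nat -> R -> Prop,
    (forall n x y, U n x -> U n y -> Rabs (x - y) <= kappa / INR (S n)) /\
    (forall x, exists n, U n x).
Proof.
  intros Hkappa. set (T := fun m => kappa / 2 * ln (INR (S m))).
  exists (fun n x => T (n / 2)%nat <= Rabs x <= T (S (n / 2))
                     /\ if Nat.even n then 0 <= x else x <= 0).
  split.
  - intros n x y [Hx Sx] [Hy Sy].
    assert (HT : T (S (n / 2)) - T (n / 2)%nat <= kappa / INR (S n)).
    { set (m := (n / 2)%nat).
      assert (Hm : 0 < INR (S m)) by (apply lt_0_INR; lia).
      assert (Hn : INR (S n) <= 2 * INR (S m)).
      { rewrite <- (mult_INR 2). apply le_INR.
        pose proof (Nat.div_mod_eq n 2). pose proof (Nat.mod_upper_bound n 2). lia. }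
      pose proof (ln_increment_bounds _ Hm) as [_ Hln].
      apply Rle_trans with (kappa / 2 * / INR (S m)).
      - unfold T. rewrite (S_INR (S m)). nra.
      - replace (kappa / 2 * / INR (S m)) with (kappa / (2 * INR (S m))) by (field; lra).
        apply Rmult_le_compat_l; [lra|].
        apply Rinv_le_contravar; [apply lt_0_INR; lia | assumption]. }
    apply Rabs_le. destruct (Nat.even n); unfold Rabs in *; repeat destruct Rcase_abs; lra.
  - intros x. pose proof (Rabs_pos x).
    destruct (ln_INR_bracket (Rabs x / (kappa / 2))) as [m [Hl Hu]].
    { apply Rle_div_r; lra. }
    apply Rle_div_r in Hl; [|lra]. apply Rle_div_l in Hu; [|lra].
    destruct (Rle_lt_dec 0 x) as [Hx|Hx].
    + exists (2 * m)%nat. rewrite Nat.even_even, (Nat.mul_comm 2), Nat.div_mul by lia.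
      unfold T. lra.
    + exists (2 * m + 1)%nat. rewrite Nat.even_odd.
      replace ((2 * m + 1) / 2)%nat with m by (apply Nat.div_unique with 1%nat; lia).
      unfold T. lra.
Qed.

Lemma hpow_div_INR_le kappa s n :
  0 < kappa <= 1 -> 1 <= s ->
  hpow (kappa / INR (S n)) s <= kappa * Rpower (INR (S n)) (- s).
Proof.
  intros Hkappa Hs. assert (Hn : 0 < INR (S n)) by (apply lt_0_INR; lia).
  unfold hpow. destruct Rle_dec as [H|_].
  - apply Rmult_le_pos; [lra | left; apply exp_pos].
  - unfold Rdiv. rewrite <- Rpower_mult_distr by (try apply Rinv_0_lt_compat; lra).
    replace (Rpower (/ INR (S n)) s) with (Rpower (INR (S n)) (- s))
      by (unfold Rpower; rewrite ln_Rinv by assumption; f_equal; ring).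
    apply Rmult_le_compat_r; [left; apply exp_pos|].
    rewrite <- (Rpower_1 kappa) at 2 by lra. now apply Rpower_le_exponent.
Qed.

Lemma Hausdorff_null_gt_1 (E : R -> Prop) s : 1 < s -> Hausdorff_null s E.
Proof.
  intros Hs delta Hdelta eps Heps. rewrite Rplus_0_l.
  set (zeta := 1 + / (s - 1)).
  assert (Hzeta : 0 < zeta).
  { unfold zeta. assert (0 < / (s - 1)) by (apply Rinv_0_lt_compat; lra). lra. }
  set (kappa := Rmin delta (Rmin 1 (eps / zeta))).
  assert (Hkappa : 0 < kappa)
    by (repeat apply Rmin_glb_lt; [lra | lra | now apply Rdiv_lt_0_compat]).
  assert (Hkappa_delta : kappa <= delta) by apply Rmin_l.
  assert (Hkappa_1 : kappa <= 1) by (eapply Rle_trans; [apply Rmin_r | apply Rmin_l]).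
  assert (Hkappa_eps : kappa * zeta <= eps)
    by (apply Rle_div_r; [lra | eapply Rle_trans; apply Rmin_r]).
  destruct (harmonic_cover_of_line kappa Hkappa) as (U & Hdiam & Hcover).
  exists U, (fun n => kappa / INR (S n)). repeat split.
  - apply Rle_div_r; [apply lt_0_INR; lia | lra].
  - apply Rle_div_l; [apply lt_0_INR; lia|].
    pose proof (le_INR 1 (S n) ltac:(lia)) as Hn. simpl (INR 1) in Hn. nra.
  - exact Hdiam.
  - auto.
  - intros N. rewrite sum_f_R0_Rsum. apply Rle_trans with (kappa * zeta); [|assumption].
    apply Rle_trans with (Rsum (fun n => kappa * Rpower (INR (S n)) (- s)) (seq 0 (S N))).
    + apply Rsum_le. intros n _. apply hpow_div_INR_le; lra.
    + rewrite Rsum_scal_l. apply Rmult_le_compat_l; [lra|].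
      rewrite <- (Rsum_map (fun k => Rpower (INR k) (- s)) S), seq_shift.
      replace (- s) with (1 - s - 1) by ring.
      eapply Rle_trans; [apply Rsum_Rpower_le; lia || lra|].
      assert (0 < Rpower (INR (S N)) (1 - s)) by apply exp_pos.
      unfold zeta. apply Rplus_le_compat_l.
      replace ((Rpower (INR (S N)) (1 - s) - 1) / (1 - s))
        with ((1 - Rpower (INR (S N)) (1 - s)) / (s - 1)) by (field; lra).
      apply Rle_div_l; [lra|]. rewrite Rinv_l; lra.
Qed.

Lemma Hausdorff_null_subset s (E F : R -> Prop) :
  (forall x, E x -> F x) -> Hausdorff_null s F -> Hausdorff_null s E.
Proof.
  intros Hsub HF delta Hdelta eps Heps.
  destruct (HF delta Hdelta eps Heps) as (U & d & Hd & Hdiam & Hcover & Hsum).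
  exists U, d. auto 6.
Qed.

Lemma is_hausdorff_dim_1 (E : R -> Prop) :
  (forall s, 0 <= s -> Hausdorff_null s E -> 1 <= s) -> is_hausdorff_dim E 1.
Proof.
  intros H. split; [now intros s [Hs Hnull]; apply H|].
  intros b Hb. apply Rnot_lt_le. intros Hlt.
  specialize (Hb ((1 + b) / 2)).
  assert (b <= (1 + b) / 2); [|lra].
  apply Hb. split; [lra | apply Hausdorff_null_gt_1; lra].
Qed.

Lemma Hausdorff_null_positive_cover (E : R -> Prop) s t delta eps :
  s <= t -> 0 < t -> 0 < delta -> 0 < eps -> Hausdorff_null s E ->
  exists (U : nat -> R -> Prop) (d : nat -> R),
    (forall n, 0 < d n < delta) /\
    (forall n x y, U n x -> U n y -> Rabs (x - y) <= d n) /\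
    (forall x, E x -> exists n, U n x) /\
    (forall F, Rsum (fun n => Rpower (d n) t) (seq 0 F) <= eps).
Proof.
  intros Hst Ht Hdelta Heps Hnull.
  assert (Hdelta' : 0 < Rmin (delta / 2) 1) by (apply Rmin_glb_lt; lra).
  pose proof (Rmin_l (delta / 2) 1) as Hmin_delta. pose proof (Rmin_r (delta / 2) 1) as Hmin_1.
  destruct (Hnull _ Hdelta' (eps / 2)) as (U & d & Hd & Hdiam & Hcover & Hsum); [lra|].
  (* Some [d n] may vanish: enlarge them all by a summable amount. *)
  set (eta := fun n => Rmin (Rmin (delta / 2) 1) (Rpower (eps / 2 * / 2 ^ S n) (/ t))).
  assert (Heta : forall n, 0 < eta n <= Rmin (delta / 2) 1).
  { intros n. split; [apply Rmin_glb_lt; [assumption | apply exp_pos] | apply Rmin_l]. }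
  assert (Heta_pow : forall n, Rpower (eta n) t <= eps / 2 * / 2 ^ S n).
  { intros n. assert (Hn : 0 < eps / 2 * / 2 ^ S n)
      by (apply Rmult_lt_0_compat; [lra | apply Rinv_0_lt_compat, pow2_pos]).
    rewrite <- (Rpower_1 (eps / 2 * / 2 ^ S n)) by assumption.
    rewrite <- (Rinv_l t), <- Rpower_mult by lra.
    apply Rle_Rpower_l; [lra|]. split; [apply Heta | apply Rmin_r]. }
  exists U, (fun n => Rmax (d n) (eta n)). split; [|split; [|split; [exact Hcover|]]].
  - intros n. specialize (Hd n). specialize (Heta n).
    split; [apply Rlt_le_trans with (2 := Rmax_r _ _) | apply Rmax_lub_lt]; lra.
  - intros n x y Hx Hy. apply Rle_trans with (2 := Rmax_l _ _). now apply (Hdiam n).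
  - intros F. apply Rle_trans with
      (Rsum (fun n => hpow (d n) s + eps / 2 * / 2 ^ S n) (seq 0 F)).
    + apply Rsum_le. intros n _. specialize (Hd n). specialize (Heta n).
      specialize (Heta_pow n).
      assert (0 < Rpower (d n) s) by apply exp_pos.
      assert (0 < Rpower (eta n) t) by apply exp_pos.
      unfold Rmax, hpow. destruct (Rle_dec (d n) (eta n)), (Rle_dec (d n) 0); try lra.
      pose proof (Rpower_le_exponent (d n) s t). lra.
    + rewrite Rsum_plus, Rsum_scal_l. pose proof (Rsum_pow_half_le F).
      assert (Rsum (fun n => hpow (d n) s) (seq 0 F) <= eps / 2); [|nra].
      destruct F as [|F]; [unfold Rsum; simpl; lra|].
      specialize (Hsum F). rewrite sum_f_R0_Rsum in Hsum. lra.
Qed.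

Definition badly_approximable (psi : nat -> R) (x : R) : Prop :=
  exists N, forall q, (N <= q)%nat -> psi q <= dist_nint (INR q * x).

Lemma badly_approximable_null_exponent_ge_1 psi N s :
  admissible_radii psi N -> 0 <= s -> Hausdorff_null s (badly_approximable psi) ->
  1 <= s.
Proof.
  intros Hpsi Hs Hnull. apply Rnot_lt_le. intros Hs1.
  set (t := (1 + s) / 2).
  destruct (INR_archimed (1 - t) 4) as [N2 HN2]; [unfold t; lra|].
  set (N0 := Nat.max N N2). pose proof (pow2_pos (5 * N0)).
  destruct (Hausdorff_null_positive_cover (badly_approximable psi) s t (/ 2 ^ (5 * N0)) 1)
    as (U & d & Hd & Hdiam & Hcover & Hsum); try assumption; try (unfold t; lra).
  { now apply Rinv_0_lt_compat. }
  destruct (exists_avoiding_point psi N0 U d t) as (x & Hx & HU); try assumption.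
  - apply admissible_radii_mono with (2 := Hpsi). unfold N0. lia.
  - assert (INR N2 <= INR N0) by (apply le_INR; unfold N0; lia). unfold t in *. nra.
  - apply Hd.
  - intros k. apply Rlt_div_r; [assumption|]. rewrite Rdiv_1_l. apply Hd.
  - destruct (Hcover x) as [n Hn]; [now exists (2 ^ N0)%nat | now apply (HU n)].
Qed.

(** * The p-adic weight *)

Lemma vp_aux_divide fuel p q : Nat.divide (p ^ vp_aux fuel p q) q.
Proof.
  revert q. induction fuel as [|f IH]; intros q; simpl; [apply Nat.divide_1_l|].
  destruct (q =? 0)%nat; [apply Nat.divide_1_l|].
  destruct (Nat.eqb_spec (q mod p) 0) as [Hq|]; [|apply Nat.divide_1_l].
  apply Nat.Div0.div_exact in Hq. rewrite Hq at 2. apply Nat.mul_divide_mono_l, IH.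
Qed.

Definition free_part (p q : nat) : nat := (q / p ^ vp p q)%nat.

Lemma vp_free_part p q : q = (p ^ vp p q * free_part p q)%nat.
Proof.
  destruct (vp_aux_divide q p q) as [m Hm]. fold (vp p q) in Hm.
  apply Nat.Div0.div_exact. rewrite Hm at 1. apply Nat.Div0.mod_mul.
Qed.

Lemma free_part_pos p q : (1 <= q)%nat -> (1 <= free_part p q)%nat.
Proof. pose proof (vp_free_part p q). destruct (free_part p q); lia. Qed.

Lemma pow_vp_bounds p q : (2 <= p)%nat -> (1 <= q)%nat -> (2 ^ vp p q <= p ^ vp p q <= q)%nat.
Proof.
  intros Hp Hq. split; [now apply Nat.pow_le_mono_l|].
  pose proof (vp_free_part p q). pose proof (free_part_pos p q Hq). nia.
Qed.

Lemma Rsum_over_valuations_le p (f g : nat -> R) m n :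
  (2 <= p)%nat -> (forall k, 0 <= f k) -> (forall k, 0 <= g k) ->
  Rsum (fun q => f (S (vp p q)) * g (free_part p q)) (dyadic_range m n)
    <= Rsum f (seq 1 n) * Rsum g (seq 1 (2 ^ n)).
Proof.
  intros Hp Hf Hg. set (split_q := fun q => (S (vp p q), free_part p q)).
  rewrite <- Rsum_list_prod.
  rewrite <- (Rsum_map (fun km => f (fst km) * g (snd km)) split_q).
  apply Rsum_incl.
  - apply Injective_map_NoDup; [|apply seq_NoDup]. intros q q' Heq. injection Heq as Hv Hm.
    now rewrite (vp_free_part p q), (vp_free_part p q'), Hv, Hm.
  - intros km Hkm. apply in_map_iff in Hkm as (q & <- & Hq). apply in_dyadic_range in Hq.
    assert (Hq1 : (1 <= q)%nat) by (pose proof (Nat.pow_nonzero 2 m); lia).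
    pose proof (pow_vp_bounds p q Hp Hq1) as Hv. pose proof (free_part_pos p q Hq1).
    pose proof (vp_free_part p q). pose proof (Nat.pow_nonzero 2 (vp p q)).
    assert (vp p q < n)%nat by (apply (Nat.pow_lt_mono_r_iff 2); lia).
    unfold split_q. rewrite in_prod_iff, !in_seq. split; [lia | nia].
  - intros km. now apply Rmult_le_pos.
Qed.

Definition weight (a : R) (p q : nat) : R :=
  INR q * Rpower (ln (INR q)) (2 - a) * padic_abs p q * Rpower (ln (2 / padic_abs p q)) a.

Lemma weight_free_part a p q :
  (2 <= p)%nat ->
  weight a p q = INR (free_part p q) * Rpower (ln (INR q)) (2 - a)
                 * Rpower (ln (2 * INR (p ^ vp p q))) a.
Proof.
  intros Hp. unfold weight, padic_abs. rewrite <- pow_INR.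
  assert (HP : 0 < INR (p ^ vp p q)).
  { apply lt_0_INR. pose proof (Nat.pow_nonzero p (vp p q)). lia. }
  replace (2 / / INR (p ^ vp p q)) with (2 * INR (p ^ vp p q)) by (field; lra).
  rewrite (vp_free_part p q) at 1. rewrite mult_INR. field. lra.
Qed.

Lemma ln_pow2_bounds n : INR n / 2 <= ln (2 ^ n) <= INR n.
Proof.
  rewrite ln_pow by lra. pose proof (pos_INR n). pose proof ln_lt_2.
  assert (ln 2 <= 1) by (rewrite <- (ln_exp 1); apply ln_le; pose proof (exp_ineq1_le 1); lra).
  nra.
Qed.

Lemma Rpower_le_of_half_le x y z n :
  0 < x -> x / 2 <= y -> 0 <= z <= INR n -> (/ 2) ^ n * Rpower x z <= Rpower y z.
Proof.
  intros Hx Hxy Hz.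
  apply Rle_trans with (Rpower (/ 2 * x) z); [|apply Rle_Rpower_l; lra].
  rewrite <- Rpower_mult_distr by lra.
  apply Rmult_le_compat_r; [left; apply exp_pos|].
  rewrite <- Rpower_pow by lra. apply Rpower_le_exponent; lra.
Qed.

Lemma weight_ge a p N q :
  0 <= a <= 1 -> (2 <= p)%nat -> (1 <= N)%nat -> (2 ^ N <= q)%nat ->
  Rpower (INR N) (2 - a) * Rpower (INR (S (vp p q))) a * INR (free_part p q) / 8
    <= weight a p q.
Proof.
  intros Ha Hp HN Hq. rewrite weight_free_part by assumption.
  assert (Hlog : (/ 2) ^ 2 * Rpower (INR N) (2 - a) <= Rpower (ln (INR q)) (2 - a)).
  { apply Rpower_le_of_half_le; [apply lt_0_INR; lia | | simpl; lra].
    eapply Rle_trans; [apply ln_pow2_bounds|].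
    apply ln_le; [apply pow2_pos|]. rewrite <- INR_pow2. now apply le_INR. }
  assert (Hval : (/ 2) ^ 1 * Rpower (INR (S (vp p q))) a
                 <= Rpower (ln (2 * INR (p ^ vp p q))) a).
  { apply Rpower_le_of_half_le; [apply lt_0_INR; lia | | simpl; lra].
    eapply Rle_trans; [apply ln_pow2_bounds|].
    apply ln_le; [apply pow2_pos|]. apply Rmult_le_compat_l; [lra|].
    change (2 ^ vp p q <= INR (p ^ vp p q)).
    rewrite <- INR_pow2. now apply le_INR, Nat.pow_le_mono_l. }
  set (X := Rpower (INR N) (2 - a)) in *. set (Y := Rpower (INR (S (vp p q))) a) in *.
  assert (HX : 0 < X) by apply exp_pos. assert (HY : 0 < Y) by apply exp_pos.
  simpl in Hlog, Hval.
  replace (X * Y * INR (free_part p q) / 8)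
    with (INR (free_part p q) * (/ 2 * (/ 2 * 1) * X) * (/ 2 * 1 * Y)) by field.
  pose proof (pos_INR (free_part p q)).
  apply Rmult_le_compat; [nra | lra | now apply Rmult_le_compat_l | exact Hval].
Qed.

Lemma weight_ge_eighth a p q :
  0 <= a <= 1 -> (2 <= p)%nat -> (2 <= q)%nat -> / 8 <= weight a p q.
Proof.
  intros Ha Hp Hq. eapply Rle_trans; [|apply (weight_ge a p 1); auto; simpl; lia].
  rewrite Rpower_1_l.
  assert (Hval : 1 <= Rpower (INR (S (vp p q))) a).
  { rewrite <- (Rpower_1_l a). apply Rle_Rpower_l; [lra|].
    split; [lra | apply (le_INR 1); lia]. }
  pose proof (le_INR _ _ (free_part_pos p q ltac:(lia))) as Hfree. simpl in Hfree. nra.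
Qed.

Lemma weight_le a p q :
  0 <= a <= 1 -> (2 <= p)%nat -> (2 <= q)%nat -> weight a p q <= 4 * INR q ^ 3.
Proof.
  intros Ha Hp Hq. rewrite weight_free_part by assumption.
  pose proof (pow_vp_bounds p q Hp ltac:(lia)) as [Hpow Hvp].
  pose proof (vp_free_part p q) as Hfactor. pose proof (Nat.pow_nonzero 2 (vp p q)).
  assert (Hfree : INR (free_part p q) <= INR q) by (apply le_INR; nia).
  assert (HP1 : 1 <= INR (p ^ vp p q)) by (apply (le_INR 1); lia).
  apply le_INR in Hvp, Hq. simpl (INR 2) in Hq.
  set (L := ln (2 * INR q)).
  assert (Hln : forall y, 1 < y <= 2 * INR q -> 0 < ln y <= L).
  { intros y Hy. split; [rewrite <- ln_1; apply ln_increasing | apply ln_le]; lra. }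
  assert (HL : L <= 2 * INR q).
  { unfold L. rewrite <- (ln_exp (2 * INR q)) at 2. apply ln_le; [lra|].
    pose proof (exp_ineq1_le (2 * INR q)). lra. }
  assert (HL0 : 0 < L) by (apply (Hln (2 * INR q)); lra).
  assert (Hlogs : Rpower (ln (INR q)) (2 - a) * Rpower (ln (2 * INR (p ^ vp p q))) a
                  <= L ^ 2).
  { rewrite <- Rpower_pow by assumption. simpl INR. replace (1 + 1) with (2 - a + a) by ring.
    rewrite Rpower_plus.
    apply Rmult_le_compat; try (left; apply exp_pos);
      (apply Rle_Rpower_l; [lra | apply Hln; lra]). }
  rewrite Rmult_assoc. apply Rle_trans with (INR q * L ^ 2).
  - apply Rmult_le_compat; [apply pos_INR | | assumption..].
    apply Rmult_le_pos; left; apply exp_pos.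
  - assert (L ^ 2 <= (2 * INR q) ^ 2) by (apply pow_incr; lra). nra.
Qed.

Lemma weight_inv_le a p N q :
  0 <= a <= 1 -> (2 <= p)%nat -> (1 <= N)%nat -> (2 ^ N <= q)%nat ->
  / weight a p q
    <= 8 * Rpower (INR N) (a - 2) * (Rpower (INR (S (vp p q))) (- a) * / INR (free_part p q)).
Proof.
  intros Ha Hp HN Hq.
  assert (Hq1 : (1 <= q)%nat) by (pose proof (Nat.pow_nonzero 2 N); lia).
  assert (Hfree : 0 < INR (free_part p q)) by (apply lt_0_INR, free_part_pos, Hq1).
  replace (a - 2) with (- (2 - a)) by ring. rewrite !Rpower_Ropp.
  pose proof (weight_ge a p N q Ha Hp HN Hq) as Hw.
  set (X := Rpower (INR N) (2 - a)) in *. set (Y := Rpower (INR (S (vp p q))) a) in *.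
  assert (HX : 0 < X) by apply exp_pos. assert (HY : 0 < Y) by apply exp_pos.
  apply Rinv_le_contravar in Hw.
  - eapply Rle_trans; [exact Hw|]. apply Req_le. field. lra.
  - apply Rdiv_lt_0_compat; [|lra]. repeat apply Rmult_lt_0_compat; assumption.
Qed.

Lemma Rsum_neg_power_le a n :
  0 <= a < 1 -> (1 <= n)%nat ->
  Rsum (fun k => Rpower (INR k) (- a)) (seq 1 n) <= Rpower (INR n) (1 - a) / (1 - a).
Proof.
  intros Ha Hn. replace (- a) with (1 - a - 1) by ring.
  eapply Rle_trans; [apply Rsum_Rpower_le; lra || assumption|].
  assert (1 <= / (1 - a)) by (rewrite <- Rinv_1; apply Rinv_le_contravar; lra).
  unfold Rdiv. lra.
Qed.

Lemma harmonic_sum_pow2_le n : Rsum (fun k => / INR k) (seq 1 (2 ^ n)) <= 1 + INR n.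
Proof.
  eapply Rle_trans; [apply harmonic_sum_le; pose proof (Nat.pow_nonzero 2 n); lia|].
  rewrite INR_pow2. apply Rplus_le_compat_l, ln_pow2_bounds.
Qed.

Lemma inv_INR_nonneg n : 0 <= / INR n.
Proof.
  destruct n as [|n]; [simpl; rewrite Rinv_0; apply Rle_refl|].
  left. apply Rinv_0_lt_compat, lt_0_INR. lia.
Qed.

Lemma Rpower_mult_le x y z : 1 <= x -> 0 < y -> z <= 1 -> Rpower (x * y) z <= x * Rpower y z.
Proof.
  intros Hx Hy Hz. rewrite <- Rpower_mult_distr by lra.
  apply Rmult_le_compat_r; [left; apply exp_pos|].
  rewrite <- (Rpower_1 x) at 2 by lra. now apply Rle_Rpower.
Qed.

Lemma Rsum_weight_inv_le a p N :
  0 <= a < 1 -> (2 <= p)%nat -> (1 <= N)%nat ->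
  Rsum (fun q => / weight a p q) (dyadic_range N (5 * N)) <= 240 / (1 - a).
Proof.
  intros Ha Hp HN.
  pose proof (le_INR 1 N HN) as HN1. simpl (INR 1) in HN1.
  set (X := Rpower (INR N) (a - 2)). set (Y := Rpower (INR N) (1 - a)).
  assert (HX : 0 < X) by apply exp_pos. assert (HY : 0 < Y) by apply exp_pos.
  assert (HXY : X * (Y * INR N) = 1).
  { unfold X, Y. rewrite <- (Rpower_1 (INR N)) at 3 by lra. rewrite <- !Rpower_plus.
    replace (a - 2 + (1 - a + 1)) with 0 by ring. apply Rpower_O. lra. }
  assert (H5N : INR (5 * N) = 5 * INR N) by (rewrite mult_INR; simpl (INR 5); ring).
  assert (Hpowers : Rsum (fun k => Rpower (INR k) (- a)) (seq 1 (5 * N)) <= 5 * Y / (1 - a)).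
  { eapply Rle_trans; [apply Rsum_neg_power_le; [assumption | lia]|].
    apply Rmult_le_compat_r; [left; apply Rinv_0_lt_compat; lra|].
    rewrite H5N. apply Rpower_mult_le; lra. }
  assert (Hharmonic : Rsum (fun m => / INR m) (seq 1 (2 ^ (5 * N))) <= 6 * INR N).
  { eapply Rle_trans; [apply harmonic_sum_pow2_le | rewrite H5N; lra]. }
  apply Rle_trans with (8 * X * (5 * Y / (1 - a) * (6 * INR N))).
  - eapply Rle_trans; [apply Rsum_le; intros q Hq; apply (weight_inv_le a p N q);
      [lra | assumption | assumption | now apply in_dyadic_range in Hq]|].
    rewrite Rsum_scal_l. apply Rmult_le_compat_l; [fold X; lra|].
    eapply Rle_trans; [apply (Rsum_over_valuations_le p
      (fun k => Rpower (INR k) (- a)) (fun m => / INR m));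
      [assumption | intros k; left; apply exp_pos | apply inv_INR_nonneg]|].
    apply Rmult_le_compat; [| | assumption..]; apply Rsum_nonneg; intros k _;
      [left; apply exp_pos | apply inv_INR_nonneg].
  - replace (8 * X * (5 * Y / (1 - a) * (6 * INR N)))
      with (240 / (1 - a) * (X * (Y * INR N))) by (field; lra).
    rewrite HXY. lra.
Qed.

(* [240 / (1 - a)] bounds the sum of the inverse weights over a stage and [/ 144] is the
   admissible sum of radii. *)
Definition radius_constant (a : R) : R := (1 - a) / (144 * 240).

Definition removal_radius (a : R) (p q : nat) : R := radius_constant a / weight a p q.

Lemma removal_radius_admissible a p :
  0 <= a < 1 -> (2 <= p)%nat -> exists N, admissible_radii (removal_radius a p) N.
Proof.
  intros Ha Hp. unfold removal_radius. set (c := radius_constant a).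
  assert (Hc : 0 < c <= / 16) by (unfold c, radius_constant; lra).
  destruct (INR_archimed c 4) as [M HM]; [lra|].
  exists (S M). split.
  - intros q Hq.
    assert (HMq : (M < q)%nat /\ (2 <= q)%nat).
    { pose proof (Nat.pow_gt_lin_r 2 M ltac:(lia)). simpl in Hq. lia. }
    destruct HMq as [HMq Hq2]. apply lt_INR in HMq. pose proof (pos_INR M).
    pose proof (weight_ge_eighth a p q ltac:(lra) Hp Hq2) as Hge.
    pose proof (weight_le a p q ltac:(lra) Hp Hq2) as Hle.
    split; [apply Rle_div_l; lra|].
    assert (Hq3 : 0 < INR q ^ 3) by (apply pow_lt; lra).
    replace (c / weight a p q * INR q ^ 4) with (INR q * c * INR q ^ 3 / weight a p q)
      by (field; lra).
    apply Rle_div_r; [lra|].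
    apply Rle_trans with (4 * INR q ^ 3); [lra | apply Rmult_le_compat_r; nra].
  - intros N HN. unfold Rdiv. rewrite Rsum_scal_l.
    pose proof (Rsum_weight_inv_le a p N Ha Hp ltac:(lia)) as Hsum.
    apply Rmult_le_compat_l with (r := c) in Hsum; [|lra].
    replace (c * (240 / (1 - a))) with (/ 144) in Hsum
      by (unfold c, radius_constant; field; lra).
    exact Hsum.
Qed.

Lemma badly_approximable_good a p x :
  0 <= a < 1 -> (2 <= p)%nat -> badly_approximable (removal_radius a p) x -> good_set a p x.
Proof.
  intros Ha Hp [N HN]. exists (radius_constant a). split; [unfold radius_constant; lra|].
  exists (Nat.max 2 N). intros q Hq. specialize (HN q ltac:(lia)).
  pose proof (weight_ge_eighth a p q ltac:(lra) Hp ltac:(lia)) as Hw.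
  apply Rle_div_l in HN; [|lra].
  eapply Rle_trans; [exact HN|]. unfold weight. apply Req_le. ring.
Qed.

Theorem theorem5 (a : R) (p : nat) (ha0 : 0 <= a) (ha1 : a < 1)
  (hp : prime (Z.of_nat p)) :
  is_hausdorff_dim (good_set a p) 1.
Proof.
  assert (Hp : (2 <= p)%nat) by (apply prime_ge_2 in hp; lia).
  apply is_hausdorff_dim_1. intros s Hs Hnull.
  destruct (removal_radius_admissible a p (conj ha0 ha1) Hp) as [N HN].
  apply (badly_approximable_null_exponent_ge_1 (removal_radius a p) N); [assumption..|].
  apply Hausdorff_null_subset with (2 := Hnull). intros x.
  now apply badly_approximable_good.
Qed.
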